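(* If $G$ is a connected $P_4$-free graph of order $n\geq 4$, then $\gamma_{t[1,2]}(G)=2$ if $\Delta(G)=n-1$, and $\gamma_{t[1,2]}(G)=\gamma_{[1,2]}(G)=\gamma(G)$ if $\Delta(G)<n-1$.
   Context: All graphs are finite, simple and undirected; $N(v)$ is the neighborhood of $v$ and $\Delta(G)$ the maximum degree. A graph is $P_4$-free if it has no induced subgraph isomorphic to $P_4$. $\gamma(G)$ is the domination number (minimum size of a set $D$ such that every vertex not in $D$ has a neighbor in $D$). A set $S$ is a $[1,2]$-set if it satisfies $1\leq |N(v)\cap S|\leq 2$ for every $v\in V(G)\setminus S$; $\gamma_{[1,2]}(G)$ is the minimum size of a $[1,2]$-set. A set $S$ is a total $[1,2]$-set if $1\leq |N(v)\cap S|\leq 2$ for every $v\in V(G)$; $\gamma_{t[1,2]}(G)$ is the minimum size of a total $[1,2]$-set, with $\gamma_{t[1,2]}(G)=+\infty$ if none exists. *)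

(* Defs.v *)
From mathcomp Require Import all_boot.

Set Implicit Arguments.
Unset Strict Implicit.
Unset Printing Implicit Defensive.

Record sgraph := SGraph {
  vertex :> finType;
  adj : rel vertex;
  adj_sym : symmetric adj;
  adj_irrefl : irreflexive adj }.

Definition nbhd (G : sgraph) (v : G) : {set G} := [set u | adj v u].

Definition max_degree (G : sgraph) : nat := \max_(v : G) #|nbhd v|.

(* The empty graph is connected by this definition. *)
Definition connected_graph (G : sgraph) : Prop :=
  forall u v : G, connect (@adj G) u v.

Definition path_adj (k : nat) : rel 'I_k :=
  fun i j => (i.+1 == j) || (j.+1 == i).

Lemma path_adj_sym k : symmetric (@path_adj k).
Proof. by move=> i j; rewrite /path_adj orbC. Qed.

Lemma path_adj_irrefl k : irreflexive (@path_adj k).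
Proof. by move=> i; rewrite /path_adj orbb eqn_leq ltnn. Qed.

Definition path_graph (k : nat) : sgraph :=
  SGraph (@path_adj_sym k) (@path_adj_irrefl k).

(* f is an isomorphism from H onto the subgraph of G induced by its image. *)
Definition induced_embedding (H G : sgraph) (f : H -> G) : Prop :=
  injective f /\ forall x y : H, adj (f x) (f y) = adj x y.

Definition induced_free (H G : sgraph) : Prop :=
  ~ exists f : H -> G, induced_embedding f.

Definition dominating (G : sgraph) (D : {set G}) : bool :=
  [forall (v | v \notin D), [exists u in D, adj v u]].

Definition is12_set (G : sgraph) (S : {set G}) : bool :=
  [forall (v | v \notin S), 1 <= #|nbhd v :&: S| <= 2].

Definition is_total12_set (G : sgraph) (S : {set G}) : bool :=
  [forall v, 1 <= #|nbhd v :&: S| <= 2].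

(* The whole vertex set is admissible in the next two minima, so the default
   value in [arg min] is harmless. *)
Lemma dominating_setT (G : sgraph) : dominating [set: G].
Proof. by apply/forallP => v; rewrite in_setT. Qed.

Lemma is12_setT (G : sgraph) : is12_set [set: G].
Proof. by apply/forallP => v; rewrite in_setT. Qed.

Definition gamma (G : sgraph) : nat :=
  #|[arg min_(D < [set: G] | dominating D) #|D|]|.

Definition gamma12 (G : sgraph) : nat :=
  #|[arg min_(S < [set: G] | is12_set S) #|S|]|.

(* None stands for +oo: G has no total [1,2]-set. *)
Definition gamma_t12 (G : sgraph) : option nat :=
  if [pick S : {set G} | is_total12_set S] is Some S0
  then Some #|[arg min_(S < S0 | is_total12_set S) #|S|]|
  else None.

(* Main.v *)
Require Import Defs.
From mathcomp Require Import all_boot.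

(** In a connected [P_4]-free graph, an edge [ab] maximising [#|N(a) :|: N(b)|]
    dominates every vertex. Otherwise some undominated [w] has a dominated
    neighbour [c], and [c] is adjacent to both [a] and [b] since the graph is
    [P_4]-free. The edge [ac] dominates [w], so by maximality it misses some
    [x] in [N(b)]; then [x b c w] or [a b x w] is an induced [P_4].
    The ends of such an edge form a total [1,2]-set of size 2. No total
    [1,2]-set is smaller, and no dominating set is smaller when there is no
    universal vertex. *)

Set Implicit Arguments.
Unset Strict Implicit.

(** Distinctness of the four vertices is derived: once [a] and [d] are assumed non-adjacent, any
    coincidence contradicts an adjacency or a non-adjacency. *)
Lemma no_induced_P4 (G : sgraph) (a b c d : G) :
  induced_free (path_graph 4) G ->
  adj a b -> adj b c -> adj c d -> ~~ adj a c -> ~~ adj b d -> adj a d.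
Proof.
move=> P4free ab bc cd nac nbd; apply/negPn/negP => nad; apply: P4free.
have sym := @adj_sym G; have irr := @adj_irrefl G.
have Dab : a == b = false.
  by apply/negP => /eqP E; move: ab; rewrite E irr.
have Dbc : b == c = false.
  by apply/negP => /eqP E; move: bc; rewrite E irr.
have Dcd : c == d = false.
  by apply/negP => /eqP E; move: cd; rewrite E irr.
have Dac : a == c = false.
  by apply/negP => /eqP E; move: nad; rewrite E cd.
have Dbd : b == d = false.
  by apply/negP => /eqP E; move: nad; rewrite -E ab.
have Dad : a == d = false.
  by apply/negP => /eqP E; move: nac; rewrite E sym cd.
exists (fun i : 'I_4 => nth a [:: a; b; c; d] i); split.
  have U : uniq [:: a; b; c; d].
    by rewrite /= !inE Dab Dac Dad Dbc Dbd Dcd.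
  move=> i j /eqP; rewrite (nth_uniq a (s := [:: a; b; c; d])) // => /eqP.
  exact: val_inj.
(* Of the sixteen index pairs, the six with [j < i] survive the rewriting and follow by symmetry. *)
rewrite /= => -[[|[|[|[|i]]]] //= Hi] [[|[|[|[|j]]]] //= Hj];
  rewrite /path_adj /= ?irr ?ab ?bc ?cd ?(negbTE nac) ?(negbTE nbd)
    ?(negbTE nad) //.
- by rewrite sym ab.
- by rewrite sym (negbTE nac).
- by rewrite sym bc.
- by rewrite sym (negbTE nad).
- by rewrite sym (negbTE nbd).
- by rewrite sym cd.
Qed.

Lemma connected_nbr (G : sgraph) (v : G) :
  connected_graph G -> 1 < #|G| -> exists u, adj v u.
Proof.
move=> Gconn; rewrite (cardD1 v) ltnS => /card_gt0P[u].
rewrite !inE andbT => uv; case/connectP: (Gconn v u) => [[|x p] /=].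
  by move=> _ E; rewrite E eqxx in uv.
by case/andP=> vx _ _; exists x.
Qed.

Lemma dominating_edge (G : sgraph) :
  connected_graph G -> induced_free (path_graph 4) G -> 1 < #|G| ->
  exists a b : G, adj a b /\ forall w, adj a w || adj b w.
Proof.
move=> Gconn P4free G1; have sym := @adj_sym G.
have [v _] : exists v : G, v \in G by apply/card_gt0P/ltnW.
have [u vu] := connected_nbr v Gconn G1.
pose E (e : G * G) := adj e.1 e.2.
pose N (e : G * G) := nbhd e.1 :|: nbhd e.2.
have Evu : E (v, u) by [].
case: (arg_maxnP (fun e => #|N e|) Evu) => -[a b] ab Nmax.
rewrite /E /= in ab; exists a, b; split=> // w0; pose D := N (a, b).
have inD x : (x \in D) = adj a x || adj b x by rewrite !inE.
(* The vertex [a] lies in [D] through [b], so by connectedness a closed [D] is everything. *)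
suff clD : closed (@adj G) (mem D).
  by rewrite -inD -(closed_connect clD (Gconn a w0)) inD [adj b a]sym ab orbT.
apply: intro_closed; first exact: sym_connect_sym sym.
move=> c w cw cD; apply/negPn/negP => wD.
have : w \notin D := wD; rewrite inD negb_or => /andP[naw nbw].
have /andP[ac bc] : adj a c && adj b c.
  have : c \in D := cD; rewrite inD => /orP[ac|bc].
  - rewrite ac /=; apply/negPn/negP => nbc; case/negP: nbw.
    by apply: (no_induced_P4 P4free _ ac cw) => //; rewrite sym.
  - rewrite bc andbT; apply/negPn/negP => nac; case/negP: naw.
    exact: (no_induced_P4 P4free ab bc cw).
(* Otherwise [w] would make [N (a, c)] strictly larger than the maximum [D]. *)
have /subsetPn[x] : ~~ (D \subset N (a, c)).
  apply/negP => sD; have /proper_card : D \proper N (a, c).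
    by apply/properP; split=> //; exists w; rewrite !inE ?cw ?orbT // negb_or naw.
  by rewrite ltnNge (Nmax (a, c) ac : #|N (a, c)| <= #|D|).
rewrite !inE negb_or => /orP[-> //|bx] /andP[nax ncx].
have [xw|nxw] := boolP (adj x w).
  by case/negP: naw; apply: (no_induced_P4 P4free ab bx xw).
case/negP: nxw; apply: (no_induced_P4 P4free _ bc cw) => //; rewrite sym //.
Qed.

(** The default [A] is kept apart from the optimal set [B], since each invariant fixes its own
    default. *)
Lemma card_arg_min (T : finType) (P : pred {set T}) (A B : {set T}) (k : nat) :
  P A -> P B -> #|B| = k -> (forall C, P C -> k <= #|C|) ->
  #|[arg min_(S < A | P S) #|S|]| = k.
Proof.
move=> PA PB Bk lb; case: arg_minnP => // C PC Cmin.
by apply/eqP; rewrite eqn_leq lb // andbT -Bk Cmin.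
Qed.

(** A member of [S] needs a neighbour in [S], which differs from it by irreflexivity. *)
Lemma total12_card_ge2 (G : sgraph) (S : {set G}) :
  0 < #|G| -> is_total12_set S -> 1 < #|S|.
Proof.
move=> /card_gt0P[v _] /forallP St.
have nbr x : exists2 y, adj x y & y \in S.
  by case/andP: (St x) => /card_gt0P[y]; rewrite !inE => /andP[]; exists y.
have [y _ yS] := nbr v; have [z yz zS] := nbr y.
apply/card_gt1P; exists y, z; split=> //.
by apply/eqP => E; rewrite E adj_irrefl in yz.
Qed.

Lemma edge_is_total12 (G : sgraph) (a b : G) :
  adj a b -> (forall w, adj a w || adj b w) ->
  is_total12_set [set a; b] /\ #|[set a; b]| = 2.
Proof.
move=> ab dom; have card2 : #|[set a; b]| = 2.
  by rewrite cards2; case: eqP ab => // ->; rewrite adj_irrefl.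
split=> //; apply/forallP => w; apply/andP; split; last first.
  by rewrite -card2 subset_leq_card // subsetIr.
apply/card_gt0P; case/orP: (dom w) => h; [exists a | exists b];
  by rewrite !inE eqxx ?orbT andbT adj_sym.
Qed.

Lemma gamma_t12_edge (G : sgraph) (a b : G) :
  adj a b -> (forall w, adj a w || adj b w) -> gamma_t12 G = Some 2.
Proof.
move=> ab dom; have [Tab card2] := edge_is_total12 ab dom.
rewrite /gamma_t12; case: pickP => [S TS|/(_ [set a; b])]; last by rewrite Tab.
congr Some; apply: card_arg_min TS Tab card2 _ => C.
by apply: total12_card_ge2; apply/card_gt0P; exists a.
Qed.

Lemma is12_total12 (G : sgraph) (S : {set G}) : is_total12_set S -> is12_set S.
Proof. by move=> /forallP St; apply/forallP => v; rewrite St implybT. Qed.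

Lemma dominating_is12 (G : sgraph) (S : {set G}) : is12_set S -> dominating S.
Proof.
move=> /forallP S12; apply/forallP => v; apply/implyP => vS.
have /andP[/card_gt0P[u]] := implyP (S12 v) vS.
by rewrite !inE => /andP[vu uS] _; apply/existsP; exists u; rewrite uS.
Qed.

Lemma dominating_card_ge2 (G : sgraph) (D : {set G}) :
  0 < #|G| -> max_degree G < #|G| - 1 -> dominating D -> 1 < #|D|.
Proof.
move=> /card_gt0P[v _] ltD /forallP domD; rewrite ltnNge; apply/negP => D1.
(* If [D] is empty, any vertex serves as [x]. Domination then makes [x] universal, against the
   degree bound. *)
have [x Dx] : exists x, forall u, u \in D -> u = x.
  have [->|[x xD]] := set_0Vmem D; first by exists v => u; rewrite inE.
  by exists x => u uD; apply: (card_le1_eqP D1).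
have sub : [set~ x] \subset nbhd x.
  apply/subsetP => u; rewrite !inE => ux.
  have uD : u \notin D by apply: contra ux => /Dx ->.
  have /existsP[y /andP[/Dx -> ux']] := implyP (domD u) uD.
  by rewrite adj_sym.
have := subset_leq_card sub; rewrite cardsC1 leqNgt -subn1 => /negP; apply.
by apply: leq_ltn_trans ltD; apply: (leq_bigmax x).
Qed.

Theorem theorem4p5 (G : sgraph) (n : nat) (order_G : #|G| = n) (n_ge4 : 4 <= n)
    (G_connected : connected_graph G)
    (G_P4_free : induced_free (path_graph 4) G) :
  (max_degree G = n - 1 -> gamma_t12 G = Some 2) /\
  (max_degree G < n - 1 ->
     gamma_t12 G = Some (gamma12 G) /\ gamma12 G = gamma G).
Proof.
have G1 : 1 < #|G| by rewrite order_G; apply: leq_trans n_ge4.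
have [a [b [ab dom]]] := dominating_edge G_connected G_P4_free G1.
have gt2 := gamma_t12_edge ab dom; split=> // ltD.
have [/is12_total12 S12 card2] := edge_is_total12 ab dom.
(* This bound serves both minima, as [1,2]-sets are dominating; the ends of the edge attain it. *)
have lb (C : {set G}) : dominating C -> 1 < #|C|.
  by apply: (dominating_card_ge2 (ltnW G1)); rewrite order_G.
have g12 : gamma12 G = 2.
  apply: card_arg_min (is12_setT G) S12 card2 _ => C /dominating_is12.
  exact: lb.
have g : gamma G = 2.
  exact: card_arg_min (dominating_setT G) (dominating_is12 S12) card2 lb.
by rewrite gt2 g12 g.
Qed.
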